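(* Let $\pi_2$ be the five-dimensional complex associative algebra with basis $e_1,\dots,e_5$ and nonzero products $e_1e_1=e_2$, $e_1e_2=e_2e_1=e_3$, $e_1e_4=e_4e_1=e_5$, $e_4e_4=e_5$ (all other products of basis elements are zero). The group $LocAut(\pi_2)$ of all local automorphisms of $\pi_2$ satisfies $$LocAut(\pi_2)=\{\exp(\nabla):\nabla\in LocDer(\pi_2)\},$$ where $LocDer(\pi_2)$ is the set of all local derivations of $\pi_2$ and $\exp(\nabla)=I+\sum_{n=1}^\infty \frac{\nabla^n}{n!}$, with $I$ the identity map of $\pi_2$.
   Context: An automorphism is a bijective linear map $\Phi$ with $\Phi(xy)=\Phi(x)\Phi(y)$; a linear map $\Phi$ is a local automorphism if for every $\nu$ there is an automorphism $\varphi_\nu$ with $\Phi(\nu)=\varphi_\nu(\nu)$. A derivation is a linear map $D$ with $D(xy)=D(x)y+xD(y)$; a linear map $\nabla$ is a local derivation if for every $x$ there is a derivation $D_x$ with $\nabla(x)=D_x(x)$. Local automorphisms of a finite-dimensional algebra form a group under composition. *)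

(* Defs.v *)
From HB Require Import structures.
From mathcomp Require Import all_boot all_order all_algebra.
From mathcomp Require Import all_classical all_reals all_analysis.
From mathcomp Require Import complex.
Set Implicit Arguments. Unset Strict Implicit. Unset Printing Implicit Defensive.
Import Order.TTheory GRing.Theory Num.Theory numFieldNormedType.Exports.
Local Open Scope ring_scope.

(* The complex numbers: R[i] for a real type R (any realType is a model of
   the reals), viewed as a numFieldType so that it carries its norm topology. *)
Definition Cplx (R : realType) : numFieldType := (R[i] : numFieldType).

Section Pi2.
Variable K : fieldType.

(* Elements of pi_2 are row vectors of coordinates w.r.t. e_1,...,e_5
   (index k : 'I_5 corresponds to e_(k+1)). *)
Definition pi2_e (k : nat) : 'rV[K]_5 := delta_mx 0 (inord k).

Definition pi2_table (i j : nat) : 'rV[K]_5 :=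
  match i, j with
  | 0, 0 => pi2_e 1
  | 0, 1 | 1, 0 => pi2_e 2
  | 0, 3 | 3, 0 | 3, 3 => pi2_e 4
  | _, _ => 0
  end.

Definition pi2_mul (x y : 'rV[K]_5) : 'rV[K]_5 :=
  \sum_(i < 5) \sum_(j < 5) (x 0 i * y 0 j) *: pi2_table i j.

Definition is_automorphism (B : 'M[K]_5) : Prop :=
  B \in unitmx /\
  forall x y : 'rV[K]_5, pi2_mul (x *m B) (y *m B) = pi2_mul x y *m B.

Definition is_local_automorphism (A : 'M[K]_5) : Prop :=
  forall v : 'rV[K]_5, exists B : 'M[K]_5, is_automorphism B /\ v *m A = v *m B.

Definition is_derivation (D : 'M[K]_5) : Prop :=
  forall x y : 'rV[K]_5,
    pi2_mul x y *m D = pi2_mul (x *m D) y + pi2_mul x (y *m D).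

Definition is_local_derivation (N : 'M[K]_5) : Prop :=
  forall v : 'rV[K]_5, exists D : 'M[K]_5, is_derivation D /\ v *m N = v *m D.

Definition exp_partial (N : 'M[K]_5) (k : nat) : 'M[K]_5 :=
  \sum_(n < k) (n`!%:R)^-1 *: N ^+ n.

End Pi2.

(* Main.v *)
(* With u = e1 - e4 and y = e4 one has u y = 0, so pi_2 is the direct product of
   <u, u^2, u^3> and <y, y^2>.  In the basis (u, u^2, u^3, y, y^2) the local
   derivations are exactly the matrices whose off-diagonal entries are supported
   on u -> u^2 -> u^3, y -> u^3, u -> y^2, y -> y^2 (and u -> u^3), with no
   relation between the entries, and the local automorphisms are the invertible
   matrices of that shape.  The off-diagonal entries of exp(N) are divided
   differences of exp at the diagonal entries times entries of N, plus, at
   u -> u^3, a term in the two entries of the chain u -> u^2 -> u^3.  Hence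
   exp(N) = A is solved entry by entry, once logarithms of the diagonal are
   chosen so that equal entries have equal logarithms.  *)
Require Import Defs.
From HB Require Import structures.
From mathcomp Require Import all_boot all_order all_algebra.
From mathcomp Require Import all_classical all_reals all_analysis.
From mathcomp Require Import complex ring.
Set Implicit Arguments. Unset Strict Implicit. Unset Printing Implicit Defensive.
Import Order.TTheory GRing.Theory Num.Theory numFieldNormedType.Exports.
Local Open Scope ring_scope.
Local Open Scope classical_set_scope.

(** * Coordinates and matrices of the shape [locmx] *)

Section Pi2Matrices.
Context {K : fieldType}.

Definition row5 (a b c d e : K) : 'rV[K]_5 := \row_j [:: a; b; c; d; e]`_j.

Lemma row5_eta (x : 'rV[K]_5) : x =
  row5 (x 0 (inord 0)) (x 0 (inord 1)) (x 0 (inord 2)) (x 0 (inord 3))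
       (x 0 (inord 4)).
Proof.
apply/rowP => k; rewrite mxE.
by case: k => [[|[|[|[|[|//]]]]] lt_k5] /=; congr (x _ _); apply/val_inj;
  rewrite /= inordK.
Qed.

Lemma row5_ind (P : 'rV[K]_5 -> Prop) :
  (forall a b c d e, P (row5 a b c d e)) -> forall x, P x.
Proof. by move=> Prow x; rewrite (row5_eta x). Qed.

Lemma row5_inj a b c d e a' b' c' d' e' :
  row5 a b c d e = row5 a' b' c' d' e' ->
  [/\ a = a', b = b', c = c', d = d' & e = e'].
Proof.
move=> /rowP eq_row.
split; [have := eq_row (inord 0) | have := eq_row (inord 1)
  | have := eq_row (inord 2) | have := eq_row (inord 3)
  | have := eq_row (inord 4)]; by rewrite !mxE inordK.
Qed.

Lemma row5D a b c d e a' b' c' d' e' :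
  row5 a b c d e + row5 a' b' c' d' e' =
  row5 (a + a') (b + b') (c + c') (d + d') (e + e').
Proof. by apply/rowP => -[[|[|[|[|[|//]]]]] lt_k5]; rewrite !mxE. Qed.

Lemma row5Z k a b c d e :
  k *: row5 a b c d e = row5 (k * a) (k * b) (k * c) (k * d) (k * e).
Proof. by apply/rowP => -[[|[|[|[|[|//]]]]] lt_k5]; rewrite !mxE. Qed.

Lemma row5_0 : row5 0 0 0 0 0 = 0.
Proof. by apply/rowP => -[[|[|[|[|[|//]]]]] lt_k5]; rewrite !mxE. Qed.

Lemma pi2_mul_row5 x1 x2 x3 x4 x5 y1 y2 y3 y4 y5 :
  pi2_mul (row5 x1 x2 x3 x4 x5) (row5 y1 y2 y3 y4 y5) =
  row5 0 (x1 * y1) (x1 * y2 + x2 * y1) 0 (x1 * y4 + x4 * y1 + x4 * y4).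
Proof.
rewrite /pi2_mul !big_ord_recl !big_ord0 /= !scaler0 !add0r !addr0.
apply/rowP => -[[|[|[|[|[|//]]]]] lt_k5];
  rewrite !mxE /= -!val_eqE /= !inordK //=; ring.
Qed.

(* In the basis f1 = e1 - e4, f2 = e2 - e5, f3 = e3, f4 = e4, f5 = e5 this is
   f1 -> a1 f1 + b f2 + g f3 + d f5, f2 -> a2 f2 + m f3, f3 -> a3 f3,
   f4 -> q f3 + r f4 + s f5, f5 -> p f5; the matrix is written with respect to
   the e_k. *)
Definition locmx (a1 a2 a3 r p b g m d q s : K) : 'M[K]_5 :=
  \matrix_(i, j) (nth [::]
    [:: [:: a1; b; g + q; r - a1; d - b + s];
        [:: 0; a2; m; 0; p - a2];
        [:: 0; 0; a3; 0; 0];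
        [:: 0; 0; q; r; s];
        [:: 0; 0; 0; 0; p]] i)`_j.

(** The sums [x1 + x4] and [x2 + x5] are the coordinates along f4 and f5; the subtracted terms
    convert the image back to the e_k. *)
Lemma row5_mul_locmx x1 x2 x3 x4 x5 a1 a2 a3 r p b g m d q s :
  row5 x1 x2 x3 x4 x5 *m locmx a1 a2 a3 r p b g m d q s =
  row5 (a1 * x1) (b * x1 + a2 * x2)
       (g * x1 + m * x2 + a3 * x3 + q * (x1 + x4))
       (r * (x1 + x4) - a1 * x1)
       (d * x1 + s * (x1 + x4) + p * (x2 + x5) - (b * x1 + a2 * x2)).
Proof.
apply/rowP => -[[|[|[|[|[|//]]]]] lt_k5];
  rewrite !mxE !big_ord_recl big_ord0 !mxE /=; ring.
Qed.

Lemma row5_mul_locmx_inj A a1 a2 a3 r p b g m d q s :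
  (forall x1 x2 x3 x4 x5, row5 x1 x2 x3 x4 x5 *m A =
    row5 x1 x2 x3 x4 x5 *m locmx a1 a2 a3 r p b g m d q s) ->
  A = locmx a1 a2 a3 r p b g m d q s.
Proof.
move=> eqA; apply/row_matrixP => i; rewrite !rowE.
by elim/row5_ind: (delta_mx 0 i).
Qed.

(** The only path of two arrows is f1 -> f2 -> f3, hence the single mixed term [b * m']. *)
Lemma locmxM a1 a2 a3 r p b g m d q s a1' a2' a3' r' p' b' g' m' d' q' s' :
  locmx a1 a2 a3 r p b g m d q s *m
    locmx a1' a2' a3' r' p' b' g' m' d' q' s' =
  locmx (a1 * a1') (a2 * a2') (a3 * a3') (r * r') (p * p')
    (a1 * b' + b * a2') (a1 * g' + b * m' + g * a3') (a2 * m' + m * a3')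
    (a1 * d' + d * p') (q * a3' + r * q') (r * s' + s * p').
Proof.
apply: row5_mul_locmx_inj => x1 x2 x3 x4 x5.
rewrite mulmxA !row5_mul_locmx; congr row5; ring.
Qed.

Lemma locmxD a1 a2 a3 r p b g m d q s a1' a2' a3' r' p' b' g' m' d' q' s' :
  locmx a1 a2 a3 r p b g m d q s + locmx a1' a2' a3' r' p' b' g' m' d' q' s' =
  locmx (a1 + a1') (a2 + a2') (a3 + a3') (r + r') (p + p')
    (b + b') (g + g') (m + m') (d + d') (q + q') (s + s').
Proof.
apply: row5_mul_locmx_inj => x1 x2 x3 x4 x5.
rewrite mulmxDr !row5_mul_locmx row5D; congr row5; ring.
Qed.

Lemma locmxZ k a1 a2 a3 r p b g m d q s :
  k *: locmx a1 a2 a3 r p b g m d q s =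
  locmx (k * a1) (k * a2) (k * a3) (k * r) (k * p)
    (k * b) (k * g) (k * m) (k * d) (k * q) (k * s).
Proof.
apply: row5_mul_locmx_inj => x1 x2 x3 x4 x5.
rewrite -scalemxAr !row5_mul_locmx row5Z; congr row5; ring.
Qed.

Lemma locmx0 : locmx 0 0 0 0 0 0 0 0 0 0 0 = 0.
Proof.
apply/esym/row5_mul_locmx_inj => x1 x2 x3 x4 x5.
rewrite mulmx0 row5_mul_locmx -row5_0; congr row5; ring.
Qed.

Lemma locmx1 : locmx 1 1 1 1 1 0 0 0 0 0 0 = 1%:M.
Proof.
apply/esym/row5_mul_locmx_inj => x1 x2 x3 x4 x5.
rewrite mulmx1 row5_mul_locmx; congr row5; ring.
Qed.

Lemma locmx_unit a1 a2 a3 r p b g m d q s :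
  [&& a1 != 0, a2 != 0, a3 != 0, r != 0 & p != 0] ->
  locmx a1 a2 a3 r p b g m d q s \in unitmx.
Proof.
case/and5P => a1N0 a2N0 a3N0 rN0 pN0.
(* These entries make the off-diagonal entries of [locmxM] vanish. *)
pose b' := - (b / (a1 * a2)); pose m' := - (m / (a2 * a3)).
pose g' := - ((b * m' + g / a3) / a1).
pose A' := locmx a1^-1 a2^-1 a3^-1 r^-1 p^-1 b' g' m' (- (d / (a1 * p)))
  (- (q / (a3 * r))) (- (s / (r * p))).
suff /mulmx1_unit[] : locmx a1 a2 a3 r p b g m d q s *m A' = 1%:M by [].
rewrite locmxM -locmx1 /b' /m' /g' /b' /m'; congr locmx; field;
  by rewrite ?a1N0 ?a2N0 ?a3N0 ?rN0 ?pN0.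
Qed.

(** f1 and f4 generate the two factors: squaring a f1 + b f2 + g f3 + d f5 gives a^2 f2 + 2ab f3,
    and squaring q f3 + r f4 + s f5 gives r^2 f5. *)
Lemma locmx_automorphism a r b g d q s : a != 0 -> r != 0 ->
  is_automorphism
    (locmx a (a ^+ 2) (a ^+ 3) r (r ^+ 2) b g (a * b *+ 2) d q s).
Proof.
move=> aN0 rN0; split; first by apply: locmx_unit; rewrite !expf_neq0 ?aN0 ?rN0.
elim/row5_ind => x1 x2 x3 x4 x5; elim/row5_ind => y1 y2 y3 y4 y5.
rewrite !(row5_mul_locmx, pi2_mul_row5); congr row5; ring.
Qed.

Lemma locmx_derivation a r b g d q s :
  is_derivation
    (locmx a (a *+ 2) (a *+ 3) r (r *+ 2) b g (b *+ 2) d q s).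
Proof.
elim/row5_ind => x1 x2 x3 x4 x5; elim/row5_ind => y1 y2 y3 y4 y5.
rewrite !(row5_mul_locmx, pi2_mul_row5) row5D; congr row5; ring.
Qed.

(** * Necessary form of automorphisms, derivations and their local versions *)

Lemma row5_mul x1 x2 x3 x4 x5 (A : 'M[K]_5) :
  row5 x1 x2 x3 x4 x5 *m A =
  x1 *: (row5 1 0 0 0 0 *m A) + x2 *: (row5 0 1 0 0 0 *m A)
  + x3 *: (row5 0 0 1 0 0 *m A) + x4 *: (row5 0 0 0 1 0 *m A)
  + x5 *: (row5 0 0 0 0 1 *m A).
Proof.
rewrite !scalemxAl -!mulmxDl !row5Z !row5D; congr (row5 _ _ _ _ _ *m A); ring.
Qed.

(** The hypotheses list the images of f1, ..., f5, written in the e_k. *)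
Lemma locmx_rows (A : 'M[K]_5) a1 a2 a3 r p b g m d q s :
  row5 1 0 0 (-1) 0 *m A = row5 a1 b g (- a1) (d - b) ->
  row5 0 1 0 0 (-1) *m A = row5 0 a2 m 0 (- a2) ->
  row5 0 0 1 0 0 *m A = row5 0 0 a3 0 0 ->
  row5 0 0 0 1 0 *m A = row5 0 0 q r s ->
  row5 0 0 0 0 1 *m A = row5 0 0 0 0 p ->
  A = locmx a1 a2 a3 r p b g m d q s.
Proof.
move=> A1 A2 A3 A4 A5; apply: row5_mul_locmx_inj => x1 x2 x3 x4 x5.
have -> : row5 x1 x2 x3 x4 x5 =
  x1 *: row5 1 0 0 (-1) 0 + x2 *: row5 0 1 0 0 (-1) + x3 *: row5 0 0 1 0 0
  + (x1 + x4) *: row5 0 0 0 1 0 + (x2 + x5) *: row5 0 0 0 0 1.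
  by rewrite !row5Z !row5D; congr row5; ring.
rewrite !mulmxDl -!scalemxAl A1 A2 A3 A4 A5 !row5_mul_locmx !row5Z !row5D.
by congr row5; ring.
Qed.

(** The images of the generators e1 and e4 determine those of e2, e3 and e5; the relations e2 e4 = 0
    and e1 e4 = e4 e4 then constrain the generators' images. *)
Lemma automorphism_locmx (B : 'M[K]_5) : is_automorphism B ->
  exists a r b g d q s, [/\ a != 0, r != 0 &
    B = locmx a (a ^+ 2) (a ^+ 3) r (r ^+ 2) b g (a * b *+ 2) d q s].
Proof.
case=> Bunit Bmul.
have Binj x : x *m B = 0 -> x = 0.
  by move=> xB0; rewrite -[x](mulmxK Bunit) xB0 mul0mx.
have e1N0 : (1 : K) <> 0 by apply/eqP; rewrite oner_eq0.
have [a [b [g0 [c [d0 B1]]]]] : exists a b g c d,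
  row5 1 0 0 0 0 *m B = row5 a b g c d.
  by elim/row5_ind: (_ *m B) => a b g c d; exists a, b, g, c, d.
have [p0 [q2 [q [r [s B4]]]]] : exists p q2 q r s,
  row5 0 0 0 1 0 *m B = row5 p q2 q r s.
  by elim/row5_ind: (_ *m B) => p q2 q r s; exists p, q2, q, r, s.
have B2 : row5 0 1 0 0 0 *m B = row5 0 (a ^+ 2) (a * b *+ 2) 0
    (a * c *+ 2 + c ^+ 2).
  transitivity (pi2_mul (row5 1 0 0 0 0) (row5 1 0 0 0 0) *m B).
    by rewrite pi2_mul_row5; congr (row5 _ _ _ _ _ *m B); ring.
  by rewrite -Bmul B1 pi2_mul_row5; congr row5; ring.
have B3 : row5 0 0 1 0 0 *m B = row5 0 0 (a ^+ 3) 0 0.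
  transitivity (pi2_mul (row5 1 0 0 0 0) (row5 0 1 0 0 0) *m B).
    by rewrite pi2_mul_row5; congr (row5 _ _ _ _ _ *m B); ring.
  by rewrite -Bmul B1 B2 pi2_mul_row5; congr row5; ring.
have aN0 : a != 0.
  apply/eqP => a0; have /Binj : row5 0 0 1 0 0 *m B = 0.
    by rewrite B3 a0 expr0n row5_0.
  by rewrite -row5_0 => /row5_inj[_ _ /e1N0].
have p0_0 : p0 = 0.
  have : row5 0 0 0 0 0 *m B = pi2_mul (row5 0 1 0 0 0 *m B) (row5 0 0 0 1 0 *m B).
    by rewrite Bmul pi2_mul_row5; congr (row5 _ _ _ _ _ *m B); ring.
  rewrite row5_0 mul0mx B2 B4 pi2_mul_row5 -row5_0 => /row5_inj[_ _ /esym/eqP].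
  by rewrite mul0r add0r mulf_eq0 expf_eq0 (negPf aN0) => /eqP.
have B5 : row5 0 0 0 0 1 *m B = row5 0 0 0 0 (r ^+ 2).
  transitivity (pi2_mul (row5 0 0 0 1 0) (row5 0 0 0 1 0) *m B).
    by rewrite pi2_mul_row5; congr (row5 _ _ _ _ _ *m B); ring.
  by rewrite -Bmul B4 pi2_mul_row5 p0_0; congr row5; ring.
have rN0 : r != 0.
  apply/eqP => r0; have /Binj : row5 0 0 0 0 1 *m B = 0.
    by rewrite B5 r0 expr0n row5_0.
  by rewrite -row5_0 => /row5_inj[_ _ _ _ /e1N0].
(* As e5 = e1 e4 = e4 e4, the e3-coordinate gives a q2 = 0 and the e5-coordinate gives (a + c) r =
   r^2. *)
have [q2_0 rE] : q2 = 0 /\ r = a + c.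
  have : row5 0 0 0 0 1 *m B =
      pi2_mul (row5 1 0 0 0 0 *m B) (row5 0 0 0 1 0 *m B).
    by rewrite Bmul pi2_mul_row5; congr (row5 _ _ _ _ _ *m B); ring.
  rewrite B5 B1 B4 pi2_mul_row5 p0_0 => /row5_inj[_ _ /esym/eqP + _ rr].
  rewrite mulr0 addr0 mulf_eq0 (negPf aN0) => /eqP q2_0; split=> //.
  by apply: (mulIf rN0); rewrite -expr2 rr; ring.
(* The image of f1 = e1 - e4 has e3-coordinate [g0 - q]; its f5-coordinate is its e5-coordinate
   [d0 - s] plus its f2-coordinate [b]. *)
exists a, r, b, (g0 - q), (d0 - s + b), q, s; split=> //.
apply: row5_mul_locmx_inj => x1 x2 x3 x4 x5.
rewrite row5_mul B1 B2 B3 B4 B5 row5_mul_locmx !row5Z !row5D p0_0 q2_0 rE.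
by congr row5; ring.
Qed.

(** Same generators and relations, under the Leibniz rule: the conditions become linear and are
    solved without division. *)
Lemma derivation_locmx (D : 'M[K]_5) : is_derivation D ->
  exists a r b g d q s,
    D = locmx a (a *+ 2) (a *+ 3) r (r *+ 2) b g (b *+ 2) d q s.
Proof.
move=> Dmul.
have [a [b [g0 [c [d0 D1]]]]] : exists a b g c d,
  row5 1 0 0 0 0 *m D = row5 a b g c d.
  by elim/row5_ind: (_ *m D) => a b g c d; exists a, b, g, c, d.
have [p0 [q2 [q [r [s D4]]]]] : exists p q2 q r s,
  row5 0 0 0 1 0 *m D = row5 p q2 q r s.
  by elim/row5_ind: (_ *m D) => p q2 q r s; exists p, q2, q, r, s.
have D2 : row5 0 1 0 0 0 *m D = row5 0 (a *+ 2) (b *+ 2) 0 (c *+ 2).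
  transitivity (pi2_mul (row5 1 0 0 0 0) (row5 1 0 0 0 0) *m D).
    by rewrite pi2_mul_row5; congr (row5 _ _ _ _ _ *m D); ring.
  by rewrite Dmul D1 !pi2_mul_row5 row5D; congr row5; ring.
have D3 : row5 0 0 1 0 0 *m D = row5 0 0 (a *+ 3) 0 0.
  transitivity (pi2_mul (row5 1 0 0 0 0) (row5 0 1 0 0 0) *m D).
    by rewrite pi2_mul_row5; congr (row5 _ _ _ _ _ *m D); ring.
  by rewrite Dmul D1 D2 !pi2_mul_row5 row5D; congr row5; ring.
have p0_0 : p0 = 0.
  have : row5 0 0 0 0 0 *m D =
      pi2_mul (row5 0 1 0 0 0 *m D) (row5 0 0 0 1 0) +
      pi2_mul (row5 0 1 0 0 0) (row5 0 0 0 1 0 *m D).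
    by rewrite -Dmul pi2_mul_row5; congr (row5 _ _ _ _ _ *m D); ring.
  rewrite row5_0 mul0mx D2 D4 !pi2_mul_row5 row5D -row5_0.
  by move=> /row5_inj[_ _ -> _ _]; ring.
have D5 : row5 0 0 0 0 1 *m D = row5 0 0 0 0 (r *+ 2).
  transitivity (pi2_mul (row5 0 0 0 1 0) (row5 0 0 0 1 0) *m D).
    by rewrite pi2_mul_row5; congr (row5 _ _ _ _ _ *m D); ring.
  by rewrite Dmul D4 !pi2_mul_row5 row5D p0_0; congr row5; ring.
have [q2_0 rE] : q2 = 0 /\ r = a + c.
  have : row5 0 0 0 0 1 *m D =
      pi2_mul (row5 1 0 0 0 0 *m D) (row5 0 0 0 1 0) +
      pi2_mul (row5 1 0 0 0 0) (row5 0 0 0 1 0 *m D).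
    by rewrite -Dmul pi2_mul_row5; congr (row5 _ _ _ _ _ *m D); ring.
  rewrite D5 D1 D4 !pi2_mul_row5 row5D p0_0 => /row5_inj[_ _ q2E _ rr].
  split; first by rewrite q2E; ring.
  by apply: (addIr r); rewrite -mulr2n rr; ring.
exists a, r, b, (g0 - q), (d0 - s + b), q, s.
apply: row5_mul_locmx_inj => x1 x2 x3 x4 x5.
rewrite row5_mul D1 D2 D3 D4 D5 row5_mul_locmx !row5Z !row5D p0_0 q2_0 rE.
by congr row5; ring.
Qed.

(** Evaluation at each f_i gives one row; the rows come from possibly different derivations, so
    relations between rows need not persist. *)
Lemma local_derivation_locmx (N : 'M[K]_5) : is_local_derivation N ->
  exists a1 a2 a3 r p b g m d q s, N = locmx a1 a2 a3 r p b g m d q s.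
Proof.
move=> locN.
have [_ [/derivation_locmx[a1 [? [b [g [d [? [? ->]]]]]]]]] :=
  locN (row5 1 0 0 (-1) 0).
have [_ [/derivation_locmx[a2 [? [m [? [? [? [? ->]]]]]]]]] :=
  locN (row5 0 1 0 0 (-1)).
have [_ [/derivation_locmx[a3 [? [? [? [? [? [? ->]]]]]]]]] :=
  locN (row5 0 0 1 0 0).
have [_ [/derivation_locmx[? [r [? [? [? [q [s ->]]]]]]]]] :=
  locN (row5 0 0 0 1 0).
have [_ [/derivation_locmx[? [p [? [? [? [? [? ->]]]]]]]]] :=
  locN (row5 0 0 0 0 1).
rewrite !row5_mul_locmx => N5 N4 N3 N2 N1.
exists a1, (a2 *+ 2), (a3 *+ 3), r, (p *+ 2), b, g, (m *+ 2), d, q, s.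
by apply: locmx_rows; rewrite ?N1 ?N2 ?N3 ?N4 ?N5; congr row5; ring.
Qed.

(** Row by row again; each diagonal entry is a power of a nonzero scalar. *)
Lemma local_automorphism_locmx (A : 'M[K]_5) : is_local_automorphism A ->
  exists a1 a2 a3 r p b g m d q s,
    [&& a1 != 0, a2 != 0, a3 != 0, r != 0 & p != 0] /\
    A = locmx a1 a2 a3 r p b g m d q s.
Proof.
move=> locA.
have [_ [/automorphism_locmx[a1 [? [b [g [d [? [? [? _ ->]]]]]]]]]] :=
  locA (row5 1 0 0 (-1) 0).
have [_ [/automorphism_locmx[a2 [? [m [? [? [? [? [? _ ->]]]]]]]]]] :=
  locA (row5 0 1 0 0 (-1)).
have [_ [/automorphism_locmx[a3 [? [? [? [? [? [? [? _ ->]]]]]]]]]] :=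
  locA (row5 0 0 1 0 0).
have [_ [/automorphism_locmx[? [r [? [? [? [q [s [_ ? ->]]]]]]]]]] :=
  locA (row5 0 0 0 1 0).
have [_ [/automorphism_locmx[? [p [? [? [? [? [? [_ ? ->]]]]]]]]]] :=
  locA (row5 0 0 0 0 1).
rewrite !row5_mul_locmx => A5 A4 A3 A2 A1.
exists a1, (a2 ^+ 2), (a3 ^+ 3), r, (p ^+ 2), b, g, (a2 * m *+ 2), d, q, s.
split; first by rewrite !expf_neq0 //; apply/and5P; split.
by apply: locmx_rows; rewrite ?A1 ?A2 ?A3 ?A4 ?A5; congr row5; ring.
Qed.

End Pi2Matrices.

(** * Sufficiency of the shape, by matching the matrix at one vector *)

Lemma locmx_local_derivation (K : numFieldType) (a1 a2 a3 r p b g m d q s : K) :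
  is_local_derivation (locmx a1 a2 a3 r p b g m d q s).
Proof.
pose D := fun a r b g d q s : K =>
  locmx a (a *+ 2) (a *+ 3) r (r *+ 2) b g (b *+ 2) d q s.
have derD a' r' b' g' d' q' s' : is_derivation (D a' r' b' g' d' q' s').
  exact: locmx_derivation.
elim/(@row5_ind K) => x1 x2 x3 x4 x5.
(* With [y4] and [y5] the coordinates along f4 and f5, the cases look for a nonzero coordinate along
   f1, f2 or f4, whose outgoing arrows absorb the mismatch. *)
set y4 := x1 + x4; set y5 := x2 + x5.
have [x1_0|x1N0] := eqVneq x1 0; last first.
(* The arrows from f1 are solved for the f2-, f3- and f5-coordinates. *)
- pose b' := (b * x1 + a2 * x2 - a1 *+ 2 * x2) / x1.
  exists (D a1 r b' ((g * x1 + m * x2 + a3 * x3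
    - (b' *+ 2 * x2 + a1 *+ 3 * x3)) / x1)
    ((d * x1 + p * y5 - r *+ 2 * y5) / x1) q s).
  split; rewrite // !row5_mul_locmx -/y4 -/y5; subst b'.
  by congr row5; field.
- have [x2_0|x2N0] := eqVneq x2 0.
  have [x4_0|x4N0] := eqVneq x4 0.
  (* Only f3 and f5 remain, which a derivation scales by 3a and 2r. *)
  + exists (D (a3 / 3) (p / 2) 0 0 0 0 0); split; rewrite // !row5_mul_locmx.
    by rewrite /y4 /y5 x1_0 x2_0 x4_0; congr row5; field.
  + exists (D a1 r 0 0 0 ((a3 * x3 + q * x4 - a1 *+ 3 * x3) / x4)
      ((s * x4 + p * x5 - r *+ 2 * x5) / x4)).
    split; rewrite // !row5_mul_locmx.
    by rewrite /y4 /y5 x1_0 x2_0; congr row5; field.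
(* The f2-coordinate dictates [a2 / 2]; the arrow f2 -> f3, of weight [b' *+ 2], absorbs the
   f3-coordinate. *)
- pose b' := (m * x2 + a3 * x3 + q * x4 - a2 / 2 *+ 3 * x3) / (x2 *+ 2).
  have [x4_0|x4N0] := eqVneq x4 0.
  + exists (D (a2 / 2) (p / 2) b' 0 0 0 0).
    split; rewrite // !row5_mul_locmx /y4 /y5 x1_0 x4_0 /b' x4_0.
    by congr row5; field.
  + exists (D (a2 / 2) r b' 0 0 0 ((s * x4 + (p - r *+ 2) * y5) / x4)).
    split; rewrite // !row5_mul_locmx /y4 /y5 x1_0 /b'.
    by congr row5; field; rewrite ?x2N0 ?x4N0.
Qed.

(** The same cases, but an automorphism scales f2, f3 and f5 by powers, so matching the diagonal
    takes square and cube roots. *)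
Lemma locmx_local_automorphism (K : numClosedFieldType)
    (a1 a2 a3 r p b g m d q s : K) :
  [&& a1 != 0, a2 != 0, a3 != 0, r != 0 & p != 0] ->
  is_local_automorphism (locmx a1 a2 a3 r p b g m d q s).
Proof.
case/and5P => a1N0 a2N0 a3N0 rN0 pN0.
pose B := fun a r b g d q s : K =>
  locmx a (a ^+ 2) (a ^+ 3) r (r ^+ 2) b g (a * b *+ 2) d q s.
have autB a' r' b' g' d' q' s' : a' != 0 -> r' != 0 ->
  is_automorphism (B a' r' b' g' d' q' s').
  exact: locmx_automorphism.
have root n (z : K) : z != 0 -> exists2 w, w != 0 & z = w ^+ n.+1.
  move=> zN0; exists (n.+1.-root z); last by rewrite rootCK.
  by rewrite rootC_eq0.
(* The index of [root] is one less than the degree: a cube root, then two square roots. *)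
have [c cN0 cE] := root 2 _ a3N0.
have [t tN0 tE] := root 1 _ a2N0.
have [u uN0 uE] := root 1 _ pN0.
elim/(@row5_ind K) => x1 x2 x3 x4 x5.
set y4 := x1 + x4; set y5 := x2 + x5.
have [x1_0|x1N0] := eqVneq x1 0; last first.
- pose b' := (b * x1 + a2 * x2 - a1 ^+ 2 * x2) / x1.
  exists (B a1 r b' ((g * x1 + m * x2 + a3 * x3
    - (a1 * b' *+ 2 * x2 + a1 ^+ 3 * x3)) / x1)
    ((d * x1 + p * y5 - r ^+ 2 * y5) / x1) q s).
  split; first exact: autB.
  rewrite !row5_mul_locmx -/y4 -/y5; subst b'.
  by congr row5; field.
- have [x2_0|x2N0] := eqVneq x2 0.
  have [x4_0|x4N0] := eqVneq x4 0.
  + exists (B c u 0 0 0 0 0); split; first exact: autB.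
    by rewrite !row5_mul_locmx /y4 /y5 x1_0 x2_0 x4_0 cE uE; congr row5; ring.
  + exists (B a1 r 0 0 0 ((a3 * x3 + q * x4 - a1 ^+ 3 * x3) / x4)
      ((s * x4 + p * x5 - r ^+ 2 * x5) / x4)).
    split; first exact: autB.
    by rewrite !row5_mul_locmx /y4 /y5 x1_0 x2_0; congr row5; field.
- pose b' := (m * x2 + a3 * x3 + q * x4 - t ^+ 3 * x3) / (t * x2 *+ 2).
  have [x4_0|x4N0] := eqVneq x4 0.
  + exists (B t u b' 0 0 0 0); split; first exact: autB.
    rewrite !row5_mul_locmx /y4 /y5 x1_0 x4_0 /b' x4_0 tE uE.
    by congr row5; field; rewrite ?tN0 ?x2N0.
  + exists (B t r b' 0 0 0 ((s * x4 + (p - r ^+ 2) * y5) / x4)).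
    split; first exact: autB.
    rewrite !row5_mul_locmx /y4 /y5 x1_0 /b' tE.
    by congr row5; field; rewrite ?tN0 ?x2N0 ?x4N0.
Qed.

(** * Partial sums of series weighted by inverse factorials *)

Section ExpPartialSums.
Context {F : numFieldType}.

Definition exp_sum (u : nat -> F) (k : nat) : F :=
  \sum_(0 <= n < k) n`!%:R^-1 * u n.

(** The product runs over the square i, j < k; by the binomial theorem the sum at a + b runs over
    the triangle i + j < k, and the rest of the square remains. *)
Lemma exp_sumM_sub (a b : F) k :
  exp_sum (GRing.exp a) k * exp_sum (GRing.exp b) k
    - exp_sum (GRing.exp (a + b)) k =
  \sum_(0 <= i < k) \sum_(k - i <= j < k)
    (i`!%:R^-1 * a ^+ i) * (j`!%:R^-1 * b ^+ j).
Proof.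
pose t i j := (i`!%:R^-1 * a ^+ i) * (j`!%:R^-1 * b ^+ j).
have binomial n : n`!%:R^-1 * (a + b) ^+ n = \sum_(0 <= i < n.+1) t i (n - i)%N.
  rewrite addrC exprDn mulr_sumr big_mkord; apply: eq_bigr => -[i /= lt_in] _.
  have le_in : (i <= n)%N by [].
  rewrite /t -(bin_fact le_in) -mulr_natr !natrM.
  by field; rewrite !pnatr_eq0 -!lt0n !fact_gt0 bin_gt0.
have triangle : exp_sum (GRing.exp (a + b)) k =
    \sum_(0 <= i < k) \sum_(0 <= j < k - i) t i j.
  elim: k => [|k IHk]; first by rewrite /exp_sum !big_geq.
  rewrite /exp_sum big_nat_recr //= -/(exp_sum _ _) IHk binomial.
  rewrite [in RHS](eq_big_nat _ _
    (F2 := fun i => \sum_(0 <= j < k - i) t i j + t i (k - i)%N)); last first.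
    by move=> i /andP[_ lt_ik]; rewrite subSn // big_nat_recr.
  by rewrite big_split /= [in RHS]big_nat_recr //= subnn [X in _ + X + _]big_geq // addr0.
rewrite triangle /exp_sum mulr_suml -sumrB; apply: eq_big_nat => i /andP[_ lt_ik].
rewrite mulr_sumr (big_cat_nat _ (leq_subr i k)) //= -/(t i).
by rewrite addrC addrK.
Qed.

(** The triangle inequality on that remainder bounds it by the one for the norms, a purely real
    quantity. *)
Lemma norm_exp_sumM_sub (a b : F) k :
  `|exp_sum (GRing.exp a) k * exp_sum (GRing.exp b) k
    - exp_sum (GRing.exp (a + b)) k| <=
  exp_sum (GRing.exp `|a|) k * exp_sum (GRing.exp `|b|) k
    - exp_sum (GRing.exp (`|a| + `|b|)) k.
Proof.
rewrite !exp_sumM_sub; apply: le_trans (ler_norm_sum _ _ _) _.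
apply: ler_sum => i _; apply: le_trans (ler_norm_sum _ _ _) _.
by apply: ler_sum => j _; rewrite !normrM !normrX !normfV !normr_nat.
Qed.

Definition exp_cvg (u : nat -> F) (l : F) : Prop := exp_sum u @ \oo --> l.

Lemma eq_exp_cvg u v l : u =1 v -> exp_cvg u l -> exp_cvg v l.
Proof. by move=> /funext ->. Qed.

Lemma exp_cvgD u v l l' : exp_cvg u l -> exp_cvg v l' ->
  exp_cvg (fun n => u n + v n) (l + l').
Proof.
move=> ul vl'; rewrite /exp_cvg.
have -> : exp_sum (fun n => u n + v n) = exp_sum u \+ exp_sum v.
  apply/funext => k; rewrite /exp_sum /= -big_split /=.
  by apply: eq_bigr => n _; rewrite mulrDr.
exact: cvgD.
Qed.

Lemma exp_cvgM c u l : exp_cvg u l -> exp_cvg (fun n => c * u n) (c * l).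
Proof.
move=> ul; rewrite /exp_cvg.
have -> : exp_sum (fun n => c * u n) = (fun k => c * exp_sum u k).
  apply/funext => k; rewrite /exp_sum mulr_sumr.
  by apply: eq_bigr => n _; rewrite mulrCA.
exact: cvgMr.
Qed.

(** Termwise differentiation: n / n! = 1 / (n-1)!, and the factor n kills the term at 0, where
    [n.-1] is a default. *)
Lemma exp_cvg_shift u l : exp_cvg u l ->
  exp_cvg (fun n => n%:R * u n.-1) l.
Proof.
move=> ul; rewrite /exp_cvg -cvg_shiftS /=.
suff -> : (fun k => exp_sum (fun n => n%:R * u n.-1) k.+1) = exp_sum u by [].
apply/funext => k; rewrite /exp_sum big_nat_recl // mul0r mulr0 add0r.
apply: eq_bigr => n _ /=; rewrite factS natrM invfM.
by rewrite mulrACA mulVf ?mul1r // pnatr_eq0.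
Qed.

End ExpPartialSums.

(** * The complex exponential: its series and its range *)

Section ComplexExponential.
Variable R : realType.
Local Notation C := (Cplx R).

Lemma cvg_real_complex (u : nat -> R) (l : R) :
  u @ \oo --> l -> (fun n => (u n)%:C%C : C) @ \oo --> (l%:C%C : C).
Proof.
move=> /cvgrPdist_lt ul; apply/cvgrPdist_lt => -[e e'].
rewrite ltcE /= => /andP[/eqP -> e0]; near=> n.
rewrite -rmorphB /= normc_def /= expr0n addr0 sqrtr_sqr ltcR.
near: n; exact: ul.
Unshelve. all: by end_near. Qed.

Lemma cvg0_le_real (u : nat -> C) (w : nat -> R) :
  (forall n, `|u n| <= ((w n)%:C%C : C)) -> w @ \oo --> 0 -> u @ \oo --> (0 : C).
Proof.
move=> le_uw /cvg_real_complex /cvgrPdist_lt w0; apply/cvgrPdist_lt => e e0.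
near=> n; rewrite sub0r normrN; apply: le_lt_trans (le_uw n) _.
have : `|(0%:C%C : C) - (w n)%:C%C| < e by near: n; exact: w0.
rewrite sub0r normrN; apply: le_lt_trans; apply: real_ler_norm.
exact: ger0_real (le_trans _ (le_uw n)).
Unshelve. all: by end_near. Qed.

Lemma exp_sum_real (x : R) k :
  exp_sum (GRing.exp (x%:C%C : C)) k = (exp_sum (GRing.exp x) k)%:C%C.
Proof.
rewrite /exp_sum rmorph_sum; apply: eq_bigr => n _ /=.
by rewrite rmorphM rmorphXn fmorphV rmorph_nat.
Qed.

Lemma exp_cvg_expR (x : R) : exp_cvg (GRing.exp x) (expR x).
Proof.
rewrite /exp_cvg (_ : exp_sum _ = series (exp_coeff x)).
  exact: is_cvg_series_exp_coeff.
by rewrite exp_coeffE.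
Qed.

(** Euler's form lets nonvanishing and surjectivity follow from real functions; [exp_cvg_cexp] ties
    it to the power series. *)
Definition cexp (z : C) : C :=
  (expR (complex.Re z))%:C%C * (cos (complex.Im z) +i* sin (complex.Im z))%C.

Lemma exp_cvg_real (x : R) : exp_cvg (GRing.exp (x%:C%C : C)) (expR x)%:C%C.
Proof.
rewrite /exp_cvg (_ : exp_sum _ = (fun k => (exp_sum (GRing.exp x) k)%:C%C)).
  exact/cvg_real_complex/exp_cvg_expR.
by apply/funext => k; rewrite exp_sum_real.
Qed.

Lemma exp_cvg_imag (y : R) :
  exp_cvg (GRing.exp ((0 +i* y)%C : C)) (cos y +i* sin y)%C.
Proof.
have -> : (cos y +i* sin y)%C = (cos y)%:C%C + 'i%C * (sin y)%:C%C :> C.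
  by apply/eqP; rewrite eq_complex /=; apply/andP; split; apply/eqP; ring.
rewrite /exp_cvg (_ : exp_sum _ = (fun k => (series (cos_coeff y) k)%:C%C
  + 'i%C * (series (sin_coeff y) k)%:C%C)).
  rewrite !unlock.
  apply: cvgD; first exact/cvg_real_complex/is_cvg_series_cos_coeff.
  apply: cvgMr; exact/cvg_real_complex/is_cvg_series_sin_coeff.
apply/funext => k; rewrite /exp_sum /series /= !rmorph_sum mulr_sumr -big_split.
apply: eq_bigr => n _ /=; rewrite /cos_coeff /sin_coeff /= -exprnP.
have -> : (0 +i* y)%C = 'i%C * y%:C%C :> C.
  by apply/eqP; rewrite eq_complex /=; apply/andP; split; apply/eqP; ring.
(* By parity of n: even powers feed the cosine series, odd ones the sine series. *)
have -> : ('i%C * y%:C%C : C) ^+ n =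
  ((~~ odd n)%:R * (-1) ^+ n./2)%:C%C * (y ^+ n)%:C%C
  + 'i%C * ((odd n)%:R * (-1) ^+ n.-1./2)%:C%C * (y ^+ n)%:C%C.
  rewrite exprMn rmorphXn -mulrDl; congr (_ * _).
  rewrite -{1}[n]odd_double_half exprD -muln2 mulnC exprM sqr_i.
  case: (boolP (odd n)) => [odd_n|even_n] /=.
    rewrite mul0r add0r mul1r expr1 rmorphXn rmorphN rmorph1.
    by case: n odd_n => //= n; rewrite uphalf_half => /negPf ->.
  by rewrite mul0r mulr0 addr0 expr0 !mul1r rmorphXn rmorphN rmorph1.
rewrite !(rmorphM, fmorphV, rmorph_nat) /=; ring.
Qed.

(** The product of the real and imaginary partial sums has the right limit, and its defect from the
    partial sum at z is dominated by a real defect tending to e^r e^s - e^(r+s) = 0. *)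
Lemma exp_cvg_cexp (z : C) : exp_cvg (GRing.exp z) (cexp z).
Proof.
case: z => x y; set a : C := x%:C%C; set b : C := (0 +i* y)%C.
have -> : (x +i* y)%C = a + b.
  by apply/eqP; rewrite eq_complex /= addr0 add0r !eqxx.
rewrite /exp_cvg (_ : exp_sum _ = fun k =>
    exp_sum (GRing.exp a) k * exp_sum (GRing.exp b) k
    - (exp_sum (GRing.exp a) k * exp_sum (GRing.exp b) k
       - exp_sum (GRing.exp (a + b)) k)); last first.
  by apply/funext => k; rewrite subKr.
rewrite -[cexp _]subr0; apply: cvgB.
  rewrite /cexp /= addr0 add0r.
  by apply: cvgM; [exact: exp_cvg_real | exact: exp_cvg_imag].
have normE (w : C) : exists r : R, `|w| = r%:C%C.
  by rewrite normc_def; eexists.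
have [[r rE] [s sE]] := (normE a, normE b).
pose w k := exp_sum (GRing.exp r) k * exp_sum (GRing.exp s) k
  - exp_sum (GRing.exp (r + s)) k.
apply: (@cvg0_le_real _ w) => [k|].
  apply: le_trans (norm_exp_sumM_sub _ _ _) _.
  by rewrite rE sE -rmorphD /= !exp_sum_real rmorphB rmorphM.
rewrite -[0](subrr (expR r * expR s)) -{2}expRD.
by apply: cvgB; [apply: cvgM|]; exact: exp_cvg_expR.
Qed.

Lemma cexp_neq0 z : cexp z != 0.
Proof.
rewrite mulf_neq0 // eq_complex /= negb_and.
  by rewrite expR_eq0.
rewrite -negb_and; apply/negP => /andP[/eqP c0 /eqP s0].
have /eqP := cos2Dsin2 (complex.Im z).
by rewrite c0 s0 expr0n addr0 eq_sym oner_eq0.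
Qed.

Lemma cexp_surj (w : C) : w != 0 -> exists z, cexp z = w.
Proof.
case: w => u v w0; pose r := Num.sqrt (u ^+ 2 + v ^+ 2).
have r2 : r ^+ 2 = u ^+ 2 + v ^+ 2 by rewrite sqr_sqrtr // addr_ge0 ?sqr_ge0.
have r0 : 0 < r.
  rewrite sqrtr_gt0 lt_neqAle addr_ge0 ?sqr_ge0 // andbT eq_sym.
  rewrite paddr_eq0 ?sqr_ge0 // !sqrf_eq0.
  by move: w0; rewrite eq_complex.
have rN0 := lt0r_neq0 r0.
have circle : (u / r) ^+ 2 + (v / r) ^+ 2 = 1.
  by rewrite !exprMn -mulrDl -r2 -exprMn divff // expr1n.
have c1 : -1 <= u / r <= 1.
  by rewrite -ler_norml -(@expr_le1 _ 2) // real_normK ?num_real // -circle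
    lerDl sqr_ge0.
have s_acos : sin (acos (u / r)) = `|v / r|.
  by rewrite sin_acos // -circle addrAC subrr add0r sqrtr_sqr.
(* [acos] yields an angle with nonnegative sine; a negative v takes the opposite angle. *)
have [y cy sy] : exists2 y, cos y = u / r & sin y = v / r.
  have [v0|v0] := leP 0 (v / r).
    by exists (acos (u / r)); rewrite ?acosK // s_acos ger0_norm.
  exists (- acos (u / r)); first by rewrite cosN acosK.
  by rewrite sinN s_acos ltr0_norm // opprK.
exists (ln r +i* y)%C; rewrite /cexp /= cy sy lnK ?posrE //.
apply/eqP; rewrite eq_complex /= !mul0r subr0 addr0.
by rewrite ![r * _]mulrC !divfK // !eqxx.
Qed.

End ComplexExponential.

(** * Divided differences of powers and of the exponential *)

Section DividedDifferences.
Context {F : numFieldType}.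

(* Divided differences of t^n at two and three points, by recursions that also
   cover coinciding points. *)
Fixpoint divdiff2 (x y : F) (n : nat) : F :=
  if n is n'.+1 then x * divdiff2 x y n' + y ^+ n' else 0.

Fixpoint divdiff3 (x y z : F) (n : nat) : F :=
  if n is n'.+1 then x * divdiff3 x y z n' + divdiff2 y z n' else 0.

(** Writing the difference with [-1 *] lets [exp_cvgD] and [exp_cvgM] apply directly. *)
Lemma divdiff2_neq x y n : x != y ->
  divdiff2 x y n = (x - y)^-1 * (x ^+ n + -1 * y ^+ n).
Proof.
rewrite -subr_eq0 => xyN0; elim: n => [|n IHn] /=.
  by rewrite !expr0; ring.
by rewrite IHn !exprS; field.
Qed.

Lemma divdiff2_eq x n : divdiff2 x x n = n%:R * x ^+ n.-1.
Proof.
elim: n => [|n IHn] /=; first by rewrite mul0r.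
by rewrite IHn; case: n {IHn} => [|n] /=; rewrite ?exprS; ring.
Qed.

Lemma divdiff3_neq_r x y z n : y != z ->
  divdiff3 x y z n = (y - z)^-1 * (divdiff2 x y n + -1 * divdiff2 x z n).
Proof.
move=> yz; have := yz; rewrite -subr_eq0 => yzN0.
elim: n => [|n IHn] /=; first by ring.
by rewrite IHn (divdiff2_neq _ yz); field.
Qed.

Lemma divdiff3_neq_l x y n : x != y ->
  divdiff3 x y y n = (x - y)^-1 * (divdiff2 x y n + -1 * divdiff2 y y n).
Proof.
rewrite -subr_eq0 => xyN0.
elim: n => [|n IHn] /=; first by ring.
by rewrite IHn; field.
Qed.

(** Half the second derivative of t^n; the coefficients vanish for n < 2, where predecessors
    truncate. *)
Lemma divdiff3_eq x n :
  divdiff3 x x x n = 2^-1 * (n%:R * (n.-1%:R * x ^+ n.-2)).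
Proof.
elim: n => [|n IHn] /=; first by rewrite mul0r mulr0.
rewrite IHn divdiff2_eq; case: n {IHn} => [|[|n]] /=; rewrite ?exprS; by field.
Qed.

Variable E : F -> F.
Hypothesis exp_cvg_E : forall x, exp_cvg (GRing.exp x) (E x).

Lemma exp_cvg_divdiff2_neq x y : x != y ->
  exp_cvg (divdiff2 x y) ((x - y)^-1 * (E x + -1 * E y)).
Proof.
move=> xy; apply: eq_exp_cvg => [n|]; first exact/esym/divdiff2_neq.
by apply/exp_cvgM/exp_cvgD => //; apply/exp_cvgM.
Qed.

Lemma exp_cvg_divdiff2_eq x : exp_cvg (divdiff2 x x) (E x).
Proof.
apply: eq_exp_cvg => [n|]; first exact/esym/divdiff2_eq.
exact: (exp_cvg_shift (@exp_cvg_E x)).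
Qed.

Lemma is_exp_cvg_divdiff2 x y : exists l, exp_cvg (divdiff2 x y) l.
Proof.
have [->|xy] := eqVneq x y; eexists; first exact: exp_cvg_divdiff2_eq.
exact: exp_cvg_divdiff2_neq.
Qed.

(** The limit is [E x] at coinciding points and a quotient with numerator E x - E y otherwise.
    Nonvanishing permits division by it when solving exp(N) = A. *)
Lemma exp_cvg_divdiff2_neq0 x y : E x != 0 -> (E x = E y -> x = y) ->
  exists2 l, l != 0 & exp_cvg (divdiff2 x y) l.
Proof.
move=> ExN0 Einj; have [<-|xy] := eqVneq x y.
  by exists (E x) => //; apply: exp_cvg_divdiff2_eq.
exists ((x - y)^-1 * (E x + -1 * E y)); last exact: exp_cvg_divdiff2_neq.
rewrite mulf_neq0 ?invr_eq0 ?subr_eq0 // mulN1r subr_eq0.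
by apply: contra_neq xy.
Qed.

(** Existence suffices: this limit only enters a term that is subtracted. The cases are y != z, then
    x != y = z, then all equal. *)
Lemma is_exp_cvg_divdiff3 x y z : exists l, exp_cvg (divdiff3 x y z) l.
Proof.
have [<-{z}|yz] := eqVneq y z; last first.
  have [[l xyl] [l' xzl']] :=
    (is_exp_cvg_divdiff2 x y, is_exp_cvg_divdiff2 x z).
  eexists; apply: eq_exp_cvg => [n|]; first exact/esym/divdiff3_neq_r.
  exact: (exp_cvgM (exp_cvgD xyl (exp_cvgM xzl'))).
have [<-{y}|xy] := eqVneq x y; last first.
  have [[l xyl] [l' yyl']] :=
    (is_exp_cvg_divdiff2 x y, is_exp_cvg_divdiff2 y y).
  eexists; apply: eq_exp_cvg => [n|]; first exact/esym/divdiff3_neq_l.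
  exact: (exp_cvgM (exp_cvgD xyl (exp_cvgM yyl'))).
eexists; apply: eq_exp_cvg => [n|]; first exact/esym/divdiff3_eq.
exact: (exp_cvgM (exp_cvg_shift (exp_cvg_shift (@exp_cvg_E x)))).
Qed.

End DividedDifferences.

(** * Exponentials of [locmx] matrices and the equality of the two sets *)

Section LocmxExponential.
Context {F : numFieldType}.

(** The recursions of [divdiff2] and [divdiff3] are those of left multiplication in [locmxM]. *)
Lemma locmxX (a1 a2 a3 r p b g m d q s : F) n :
  locmx a1 a2 a3 r p b g m d q s ^+ n =
  locmx (a1 ^+ n) (a2 ^+ n) (a3 ^+ n) (r ^+ n) (p ^+ n)
    (b * divdiff2 a1 a2 n)
    (g * divdiff2 a1 a3 n + (b * m) * divdiff3 a1 a2 a3 n)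
    (m * divdiff2 a2 a3 n) (d * divdiff2 a1 p n) (q * divdiff2 r a3 n)
    (s * divdiff2 r p n).
Proof.
elim: n => [|n IHn]; first by rewrite expr0 -[1]locmx1 /= !mulr0 addr0.
rewrite exprS IHn -[_ * _]/(_ *m _) locmxM /= !exprS; congr locmx; ring.
Qed.

Lemma exp_partial_locmx (a1 a2 a3 r p b g m d q s : F) k :
  exp_partial (locmx a1 a2 a3 r p b g m d q s) k =
  locmx (exp_sum (GRing.exp a1) k) (exp_sum (GRing.exp a2) k)
    (exp_sum (GRing.exp a3) k) (exp_sum (GRing.exp r) k)
    (exp_sum (GRing.exp p) k) (exp_sum (fun n => b * divdiff2 a1 a2 n) k)
    (exp_sum (fun n =>
      g * divdiff2 a1 a3 n + (b * m) * divdiff3 a1 a2 a3 n) k)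
    (exp_sum (fun n => m * divdiff2 a2 a3 n) k)
    (exp_sum (fun n => d * divdiff2 a1 p n) k)
    (exp_sum (fun n => q * divdiff2 r a3 n) k)
    (exp_sum (fun n => s * divdiff2 r p n) k).
Proof.
rewrite /exp_partial /exp_sum; elim: k => [|k IHk].
  by rewrite big_ord0 !big_geq // locmx0.
by rewrite big_ord_recr /= IHk locmxX locmxZ locmxD !big_nat_recr.
Qed.

Lemma cvg_locmx (a1 a2 a3 r p b g m d q s : nat -> F)
    (a1' a2' a3' r' p' b' g' m' d' q' s' : F) :
  a1 @ \oo --> a1' -> a2 @ \oo --> a2' -> a3 @ \oo --> a3' ->
  r @ \oo --> r' -> p @ \oo --> p' -> b @ \oo --> b' -> g @ \oo --> g' ->
  m @ \oo --> m' -> d @ \oo --> d' -> q @ \oo --> q' -> s @ \oo --> s' ->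
  (fun k => locmx (a1 k) (a2 k) (a3 k) (r k) (p k) (b k) (g k) (m k) (d k)
    (q k) (s k)) @ \oo --> locmx a1' a2' a3' r' p' b' g' m' d' q' s'.
Proof.
move=> a1P a2P a3P rP pP bP gP mP dP qP sP.
(* Linearity in the eleven parameters reduces matrix convergence to scalar convergence. *)
have locmxE x1 x2 x3 x4 x5 x6 x7 x8 x9 x10 x11 :
  locmx x1 x2 x3 x4 x5 x6 x7 x8 x9 x10 x11 =
  x1 *: locmx 1 0 0 0 0 0 0 0 0 0 0 + x2 *: locmx 0 1 0 0 0 0 0 0 0 0 0
  + x3 *: locmx 0 0 1 0 0 0 0 0 0 0 0 + x4 *: locmx 0 0 0 1 0 0 0 0 0 0 0
  + x5 *: locmx 0 0 0 0 1 0 0 0 0 0 0 + x6 *: locmx 0 0 0 0 0 1 0 0 0 0 0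
  + x7 *: locmx 0 0 0 0 0 0 1 0 0 0 0 + x8 *: locmx 0 0 0 0 0 0 0 1 0 0 0
  + x9 *: locmx 0 0 0 0 0 0 0 0 1 0 0 + x10 *: locmx 0 0 0 0 0 0 0 0 0 1 0
  + x11 *: locmx 0 0 0 0 0 0 0 0 0 0 1 :> 'M[F]_5.
  by rewrite !locmxZ !locmxD; congr locmx; ring.
rewrite locmxE; under eq_fun do rewrite locmxE.
have cvg_line (u : nat -> F) (l : F) (M : 'M[F]_5) :
  u @ \oo --> l -> (fun k => u k *: M) @ \oo --> l *: M by exact: cvgZr_tmp.
by do 10!(apply: cvgD; last exact: cvg_line); exact: cvg_line.
Qed.

Lemma exp_partial_locmx_cvg (a1 a2 a3 r p b g m d q s : F)
    a1' a2' a3' r' p' l12 l13 l123 l23 l1p lr3 lrp :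
  exp_cvg (GRing.exp a1) a1' -> exp_cvg (GRing.exp a2) a2' ->
  exp_cvg (GRing.exp a3) a3' -> exp_cvg (GRing.exp r) r' ->
  exp_cvg (GRing.exp p) p' ->
  exp_cvg (divdiff2 a1 a2) l12 -> exp_cvg (divdiff2 a1 a3) l13 ->
  exp_cvg (divdiff3 a1 a2 a3) l123 -> exp_cvg (divdiff2 a2 a3) l23 ->
  exp_cvg (divdiff2 a1 p) l1p -> exp_cvg (divdiff2 r a3) lr3 ->
  exp_cvg (divdiff2 r p) lrp ->
  exp_partial (locmx a1 a2 a3 r p b g m d q s) @ \oo -->
    locmx a1' a2' a3' r' p' (b * l12) (g * l13 + b * m * l123) (m * l23)
      (d * l1p) (q * lr3) (s * lrp).
Proof.
move=> a1P a2P a3P rP pP P12 P13 P123 P23 P1p Pr3 Prp.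
have /funext -> := exp_partial_locmx a1 a2 a3 r p b g m d q s.
by apply: cvg_locmx => //; try exact: exp_cvgM;
  apply: exp_cvgD; exact: exp_cvgM.
Qed.

End LocmxExponential.

(* LocAut(pi_2) = { exp(nabla) : nabla in LocDer(pi_2) } over the complex numbers. *)
Theorem theorem7p3 (R : realType) (A : 'M[Cplx R]_5) :
  is_local_automorphism A <->
  exists N : 'M[Cplx R]_5,
    is_local_derivation N /\ exp_partial N @ \oo --> A.
Proof.
have expP := @exp_cvg_cexp R.
have dd2 := is_exp_cvg_divdiff2 expP.
have dd3 := is_exp_cvg_divdiff3 expP.
split; last first.
  case=> _ [/local_derivation_locmx[a1 [a2 [a3 [r [p [b [g [m [d [q [s ->]]]]]]]]]]]].
  have [[l12 P12] [[l13 P13] [l123 P123]]] :=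
    (dd2 a1 a2, (dd2 a1 a3, dd3 a1 a2 a3)).
  have [[l23 P23] [l1p P1p]] := (dd2 a2 a3, dd2 a1 p).
  have [[lr3 Pr3] [lrp Prp]] := (dd2 r a3, dd2 r p).
  have lim_exp : exp_partial (locmx a1 a2 a3 r p b g m d q s) @ \oo --> _ :=
    exp_partial_locmx_cvg (expP a1) (expP a2) (expP a3) (expP r) (expP p)
      P12 P13 P123 P23 P1p Pr3 Prp.
  (* By uniqueness of limits [A] is this [locmx] matrix, with values of [cexp] on the diagonal. *)
  move=> /(cvg_unique (@norm_hausdorff _ _) lim_exp) <-.
  by apply: (@locmx_local_automorphism R[i]); rewrite !cexp_neq0.
move=> /local_automorphism_locmx.
case=> a1 [a2 [a3 [r [p [b [g [m [d [q [s [/and5P[a1N0 a2N0 a3N0 rN0 pN0] ->]]]]]]]]]]].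
(* Equal diagonal entries must get equal logarithms for the divided
   differences of exp to be nonzero: with logarithms differing by 2 pi i they
   would vanish. *)
pose ln (w : Cplx R) : Cplx R := get [set z | cexp z = w].
have lnK w : w != 0 -> cexp (ln w) = w.
  by move=> wN0; exact: (getPex (cexp_surj wN0)).
have dd2N0 w w' : w != 0 -> w' != 0 ->
  exists2 l, l != 0 & exp_cvg (divdiff2 (ln w) (ln w')) l.
  move=> wN0 w'N0; apply: (exp_cvg_divdiff2_neq0 expP).
    by rewrite lnK.
  (* Equal exponentials of chosen logarithms mean equal w and w', hence the same logarithm. *)
  by rewrite !lnK // => ->.
have ln_cvg w : w != 0 -> exp_cvg (GRing.exp (ln w)) w.
  by move=> wN0; rewrite -{2}(lnK _ wN0); exact: expP.
have [[l12 N12 P12] [l13 N13 P13]] := (dd2N0 _ _ a1N0 a2N0, dd2N0 _ _ a1N0 a3N0).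
have [[l23 N23 P23] [l1p N1p P1p]] := (dd2N0 _ _ a2N0 a3N0, dd2N0 _ _ a1N0 pN0).
have [[lr3 Nr3 Pr3] [lrp Nrp Prp]] := (dd2N0 _ _ rN0 a3N0, dd2N0 _ _ rN0 pN0).
have [l123 P123] := dd3 (ln a1) (ln a2) (ln a3).
(* The contribution of the chain f1 -> f2 -> f3 is removed before dividing. *)
pose g' := (g - b / l12 * (m / l23) * l123) / l13.
exists (locmx (ln a1) (ln a2) (ln a3) (ln r) (ln p) (b / l12) g' (m / l23)
  (d / l1p) (q / lr3) (s / lrp)).
split; first exact: locmx_local_derivation.
have -> : locmx a1 a2 a3 r p b g m d q s =
  locmx a1 a2 a3 r p (b / l12 * l12)
    (g' * l13 + b / l12 * (m / l23) * l123) (m / l23 * l23)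
    (d / l1p * l1p) (q / lr3 * lr3) (s / lrp * lrp).
  by rewrite /g' !divfK // subrK.
by apply: exp_partial_locmx_cvg; first [exact: ln_cvg | by []].
Qed.
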